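(* Let $n$ be a positive integer and let $k$ be an integer with $1 \leq k \leq \lceil \frac{n}{2} \rceil$. Then $\gamma(n,[1,n-k],[2,n]) = n-1$.
   Context: $[n]=\{1,\ldots,n\}$. A bicoloring of $[n]$ is a map $B:[n]\to\{-1,+1\}$; $B(+1)$ and $B(-1)$ denote the sets of points of $[n]$ receiving color $+1$ and $-1$, and $Y_B=(B(1),\ldots,B(n))$. A bicoloring is trivial if it is constant (monochromatic); only non-trivial bicolorings are considered. For $A\subseteq[n]$, $X_A\in\{0,1\}^n$ is the incidence vector of $A$. A non-empty set $A\subseteq [n]$ is an unbiased representative for $B$ if $\langle X_A,Y_B\rangle=0$. A family $\mathcal{A}$ of subsets of $[n]$ is a system of unbiased representatives (SUR) for a set $\mathcal{B}$ of bicolorings if every $B\in\mathcal{B}$ has an unbiased representative in $\mathcal{A}$. $\gamma(n,[k_1,k_2],[r_1,r_2])$ is the maximum, over all sets $\mathcal{B}$ of non-trivial bicolorings of $[n]$ such that $k_1\le |B(+1)|\le k_2$ for every $B\in\mathcal{B}$, of the minimum cardinality of a SUR $\mathcal{A}$ for $\mathcal{B}$ such that $r_1\le |A|\le r_2$ for every $A\in\mathcal{A}$. *)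

(* Defs.v *)
From mathcomp Require Import all_boot all_order all_algebra.

Set Implicit Arguments.
Unset Strict Implicit.
Unset Printing Implicit Defensive.

Import GRing.Theory.

(* The ground set {1, ..., n} is 'I_n, and the colors +1 and -1 are encoded as
   true and false, so that bicolorings form a finType; [color] decodes them. *)
Definition bicoloring (n : nat) := {ffun 'I_n -> bool}.

Definition color (c : bool) : int := if c then 1%R else (-1)%R.

Definition color_class n (B : bicoloring n) (c : bool) : {set 'I_n} :=
  [set i | B i == c].

Definition trivial_bicoloring n (B : bicoloring n) : bool :=
  [exists c, [forall i, B i == c]].

Definition incidence n (A : {set 'I_n}) : 'rV[int]_n :=
  (\row_i (i \in A)%:R)%R.

Definition color_vector n (B : bicoloring n) : 'rV[int]_n :=
  (\row_i color (B i))%R.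

Definition dotp n (u v : 'rV[int]_n) : int := (\sum_i u 0 i * v 0 i)%R.

Definition unbiased_rep n (B : bicoloring n) (A : {set 'I_n}) : bool :=
  (A != set0) && (dotp (incidence A) (color_vector B) == 0%R).

Definition is_SUR n (BB : {set bicoloring n}) (AA : {set {set 'I_n}}) : bool :=
  [forall B in BB, exists A in AA, unbiased_rep B A].

Definition sizes_in n (r1 r2 : nat) (AA : {set {set 'I_n}}) : bool :=
  [forall A in AA, r1 <= #|A| <= r2].

Definition admissible_bicolorings n (k1 k2 : nat) (BB : {set bicoloring n}) :
    bool :=
  [forall B in BB,
     ~~ trivial_bicoloring B && (k1 <= #|color_class B true| <= k2)].

(* Minimum cardinality of a SUR for BB all of whose members have size in
   [r1, r2]. If there is no such SUR, the value is 2 ^ n + 1, which exceeds the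
   cardinality of every family of subsets and so plays the role of infinity;
   see [min_SURP] and [min_SUR_infty]. *)
Definition min_SUR n (r1 r2 : nat) (BB : {set bicoloring n}) : nat :=
  \big[minn/(2 ^ n).+1]_(AA : {set {set 'I_n}} |
     is_SUR BB AA && sizes_in r1 r2 AA) #|AA|.

(* gamma(n, [k1, k2], [r1, r2]) *)
Definition gamma (n k1 k2 r1 r2 : nat) : nat :=
  \max_(BB : {set bicoloring n} | admissible_bicolorings k1 k2 BB)
     min_SUR r1 r2 BB.

Lemma card_family n (AA : {set {set 'I_n}}) : #|AA| <= 2 ^ n.
Proof.
by rewrite -[n in 2 ^ n]card_ord -cardsT -card_powerset powersetT cardsT
  max_card.
Qed.

Lemma min_SUR_le n r1 r2 (BB : {set bicoloring n}) AA :
  is_SUR BB AA -> sizes_in r1 r2 AA -> min_SUR r1 r2 BB <= #|AA|.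
Proof.
move=> h1 h2; rewrite /min_SUR; have := mem_index_enum AA.
elim: (index_enum _) => // A s IHs; rewrite inE big_cons.
case: eqP => [<- _|_ /= /IHs le_s]; first by rewrite h1 h2 geq_minl.
by case: ifP => // _; rewrite geq_min le_s orbT.
Qed.

Lemma min_SUR_attained n r1 r2 (BB : {set bicoloring n}) :
  min_SUR r1 r2 BB = (2 ^ n).+1 \/
  exists AA, [/\ is_SUR BB AA, sizes_in r1 r2 AA & #|AA| = min_SUR r1 r2 BB].
Proof.
rewrite /min_SUR; elim/big_ind: _ => [|x y hx hy|AA /andP[h1 h2]].
- by left.
- by rewrite /minn; case: ifP.
- by right; exists AA.
Qed.

Lemma min_SURP n r1 r2 (BB : {set bicoloring n}) m : m <= 2 ^ n ->
  min_SUR r1 r2 BB = m <->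
  (exists AA, [/\ is_SUR BB AA, sizes_in r1 r2 AA & #|AA| = m]) /\
  (forall AA, is_SUR BB AA -> sizes_in r1 r2 AA -> m <= #|AA|).
Proof.
move=> le_m; split=> [defm|[[AA [h1 h2 <-]] lb]].
  split=> [|AA]; last by rewrite -defm; exact: min_SUR_le.
  case: (min_SUR_attained r1 r2 BB); last by rewrite defm.
  by rewrite defm => em; rewrite em ltnn in le_m.
apply/eqP; rewrite eqn_leq min_SUR_le //=.
case: (min_SUR_attained r1 r2 BB) => [->|[AA' [h1' h2' <-]]]; last exact: lb.
exact: leqW (card_family _).
Qed.

Lemma min_SUR_infty n r1 r2 (BB : {set bicoloring n}) :
  min_SUR r1 r2 BB = (2 ^ n).+1 <->
  ~ exists AA, is_SUR BB AA /\ sizes_in r1 r2 AA.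
Proof.
split=> [e [AA [h1 h2]]|noSUR].
  have := leq_trans (min_SUR_le h1 h2) (card_family AA).
  by rewrite e ltnn.
case: (min_SUR_attained r1 r2 BB) => // -[AA [h1 h2 _]].
by case: noSUR; exists AA.
Qed.

(* Main.v *)
(* Upper bound: a non-constant bicoloring of {1, ..., n} takes different values
   on two consecutive points, so the n - 1 pairs {i, i + 1} form a SUR.

   Lower bound: being an unbiased representative is invariant under exchanging
   the two colors, and one of B, -B has at most n - k points of color +1, so a
   SUR AA for all bicolorings with 1 <= |B(+1)| <= n - k serves all non-trivial
   ones. Hence P(Y) = prod_(A in AA) <X_A, Y>, of degree m = |AA|, vanishes on
   {-1, +1}^n except at the two constant vectors 1 and -1, where P(1) > 0 and
   P(-1) = (-1)^m P(1). If m < n - 1, choose S with |S| in {n - 1, n} and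
   |S| = m mod 2; the sum over Y of P(Y) prod_(i in S) Y_i is 2 P(1) > 0, yet
   it is zero because deg P < |S|. *)
Require Import Defs.
From mathcomp Require Import all_boot all_order all_algebra.
From mathcomp Require Import zify.

Set Implicit Arguments.
Unset Strict Implicit.
Unset Printing Implicit Defensive.

Import Order.TTheory GRing.Theory Num.Theory.

Section Bicolorings.

Variable n : nat.
Implicit Types (A S : {set 'I_n}) (B : bicoloring n) (i : 'I_n).

Definition bias A B : int := (\sum_(i in A) color (B i))%R.

Definition flip i B : bicoloring n := [ffun j => B j (+) (j == i)].

Definition negb_coloring B : bicoloring n := [ffun j => ~~ B j].

Definition const_coloring (c : bool) : bicoloring n := [ffun=> c].

Lemma dotp_bias A B : dotp (incidence A) (color_vector B) = bias A B.
Proof.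
rewrite /dotp /bias [RHS]big_mkcond; apply: eq_bigr => i _.
by rewrite !mxE; case: (i \in A); rewrite ?mul1r ?mul0r.
Qed.

Lemma colorN c : color (~~ c) = (- color c)%R.
Proof. by case: c. Qed.

Lemma flipK i : involutive (flip i).
Proof. by move=> B; apply/ffunP => j; rewrite !ffunE addbK. Qed.

Lemma trivial_bicoloringE B :
  trivial_bicoloring B -> exists c, B = const_coloring c.
Proof.
case/existsP => c /forallP Bc; exists c.
by apply/ffunP => i; rewrite ffunE; apply/eqP.
Qed.

Lemma negb_coloringK : involutive negb_coloring.
Proof. by move=> B; apply/ffunP => i; rewrite !ffunE negbK. Qed.

Lemma trivial_negb B :
  trivial_bicoloring (negb_coloring B) = trivial_bicoloring B.
Proof.
have imp B' : trivial_bicoloring B' -> trivial_bicoloring (negb_coloring B').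
  case/trivial_bicoloringE=> c ->; apply/existsP; exists (~~ c).
  by apply/forallP => i; rewrite !ffunE.
by apply/idP/idP => [/imp|/imp //]; rewrite negb_coloringK.
Qed.

Lemma bias_negb A B : bias A (negb_coloring B) = (- bias A B)%R.
Proof.
by rewrite /bias -sumrN; apply: eq_bigr => i _; rewrite ffunE colorN.
Qed.

Lemma card_class_negb B :
  #|color_class B true| + #|color_class (negb_coloring B) true| = n.
Proof.
rewrite -[RHS]card_ord -(cardsC (color_class B true)).
congr (_ + #|pred_of_set _|).
by apply/setP => i; rewrite !inE ffunE; case: (B i).
Qed.

Lemma color_class_gt0 B c :
  ~~ trivial_bicoloring B -> 0 < #|color_class B c|.
Proof.
apply: contraR; rewrite -leqNgt leqn0 cards_eq0 => /eqP B0.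
apply/existsP; exists (~~ c); apply/forallP => i.
by have := in_set0 i; rewrite -B0 inE; case: (B i); case: (c).
Qed.

Lemma bias_const A c : bias A (const_coloring c) = (color c * #|A|%:R)%R.
Proof.
rewrite /bias (eq_bigr (fun=> color c)) => [|i _]; last by rewrite ffunE.
by rewrite sumr_const mulr_natr.
Qed.

(* The monomial indexed by [s] accumulates the variables chosen while the
   product of linear forms is expanded; a variable in [S] but not in [s] then
   occurs to an odd power, so flipping its sign cancels the sum. *)
Lemma sum_prod_bias_monomial (As : seq {set 'I_n}) (s : seq 'I_n) S :
  size As + size s < #|S| ->
  (\sum_B (\prod_(A <- As) bias A B) * ((\prod_(i <- s) color (B i)) *
     \prod_(i in S) color (B i)) = 0)%R.
Proof.
elim: As s => [|A As IHAs] s lt_S.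
  have [i iS iNs] : exists2 i, i \in S & i \notin s.
    apply/subsetPn; apply: contraL lt_S => /subset_leq_card le_Ss.
    by rewrite -leqNgt (leq_trans le_Ss) ?card_size.
  set X := LHS; suff: X = (- X)%R by lia.
  rewrite {1}/X (reindex_inj (inv_inj (flipK i))) -sumrN.
  apply: eq_bigr => B _; rewrite !big_nil !mul1r !(bigD1 i iS) /=.
  rewrite ffunE eqxx addbT colorN mulNr mulrN; congr (- (_ * (_ * _)))%R.
    apply: eq_big_seq => j js; rewrite ffunE; case: eqP => [eji|_].
      by rewrite -eji js in iNs.
    by rewrite addbF.
  by apply: eq_bigr => j /andP[_ /negPf nji]; rewrite ffunE nji addbF.
(* Expanding one form [bias A B] moves each of its variables [i] into the monomial: [As] shortens by
   one, [s] grows by one, and the bound on the sum of their sizes persists. *)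
under eq_bigr => B _ do rewrite big_cons {1}/bias -mulrA mulr_suml.
rewrite exchange_big big1 // => i iA.
rewrite -[RHS](IHAs (i :: s)); last by rewrite addnS.
by apply: eq_bigr => B _; rewrite big_cons mulrCA !mulrA.
Qed.

Lemma card_unbiased_family (AA : {set {set 'I_n}}) :
  set0 \notin AA ->
  (forall B, ~~ trivial_bicoloring B ->
     exists2 A, A \in AA & bias A B = 0%R) ->
  n - 1 <= #|AA|.
Proof.
move=> AAN0 unb; rewrite leqNgt; apply/negP => lt_AA.
have n_gt0 : 0 < n by lia.
have [S lt_S parS] : exists2 S : {set 'I_n},
    #|AA| < #|S| & odd #|S| = odd #|AA|.
  (* Both candidate sizes [n] and [n - 1] exceed [#|AA|], and their parities differ. *)
  have [eq_par|ne_par] := eqVneq (odd n) (odd #|AA|).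
    by exists setT; rewrite cardsT card_ord //; lia.
  exists [set~ Ordinal n_gt0]; rewrite cardsC1 card_ord; first by lia.
  by move: ne_par; rewrite -{1}(prednK n_gt0) oddS; do 2!case: odd.
have lt_enum : size (enum AA) + size (Nil 'I_n) < #|S| by rewrite -cardE addn0.
apply/eqP: (sum_prod_bias_monomial lt_enum).
rewrite (bigD1 (const_coloring true)) //= (bigD1 (const_coloring false)) /=;
  last by apply/eqP => /ffunP eqc; have := eqc (Ordinal n_gt0); rewrite !ffunE.
rewrite [X in (_ + (_ + X))%R]big1 ?addr0 => [|B /andP[Bt Bf]]; last first.
  have /unb [A AAA A0]: ~~ trivial_bicoloring B.
    by apply/negP => /trivial_bicoloringE [[] eB]; rewrite eB eqxx in Bt Bf.
  by rewrite big_enum (bigD1 A) //= A0 !mul0r.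
have prod_const c (T : finType) (D : {set T}) (F : T -> int) :
    (\prod_(x in D) (color c * F x) = color c ^+ #|D| * \prod_(x in D) F x)%R.
  by rewrite big_split /= prodr_const.
have evalP c : (\prod_(A <- enum AA) bias A (const_coloring c) =
    color c ^+ #|AA| * \prod_(A in AA) #|A|%:R)%R.
  by rewrite big_enum -prod_const; apply: eq_bigr => A _; rewrite bias_const.
have evalS c : (\prod_(i in S) color (const_coloring c i) = color c ^+ #|S|)%R.
  by rewrite -prodr_const; apply: eq_bigr => i _; rewrite ffunE.
(* The all-false term carries the sign [(-1) ^ (#|AA| + #|S|)], which is 1 by the choice of parity,
   so both surviving terms equal the same product of cardinals. *)
rewrite !evalP !evalS !big_nil /= !expr1n !mul1r !mulr1 mulrAC -exprD.
rewrite -signr_odd oddD parS addbb expr0 mul1r.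
have: (0 < \prod_(A in AA) #|A|%:R :> int)%R.
  apply: prodr_gt0 => A AAA; rewrite ltr0n card_gt0.
  by apply: contraNneq AAN0 => <-.
by move=> P_gt0; rewrite lt0r_neq0 ?addr_gt0.
Qed.

Lemma SUR_all_nontrivial k (AA : {set {set 'I_n}}) : k <= uphalf n ->
  is_SUR [set B | ~~ trivial_bicoloring B
                  & 1 <= #|color_class B true| <= n - k] AA ->
  forall B, ~~ trivial_bicoloring B ->
    exists2 A, A \in AA & bias A B = 0%R.
Proof.
move=> le_k /forall_inP surAA B ntB.
have surB B' : ~~ trivial_bicoloring B' -> #|color_class B' true| <= n - k ->
    exists2 A, A \in AA & bias A B' = 0%R.
  move=> ntB' leB'; have /surAA/exists_inP[A AAA]: B' \in [set B |
      ~~ trivial_bicoloring B & 1 <= #|color_class B true| <= n - k].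
    by rewrite inE ntB' color_class_gt0.
  by rewrite /unbiased_rep dotp_bias => /andP[_ /eqP bA]; exists A.
have [/(surB B ntB) //|gtB] := leqP #|color_class B true| (n - k).
have [||A AAA bA] := surB (negb_coloring B).
- by rewrite trivial_negb.
(* The exchanged class has at most [k - 1] points, and [2 * k <= n + 1] gives [k - 1 <= n - k]. *)
- by move: le_k; rewrite geq_uphalf_double; have := card_class_negb B; lia.
by exists A => //; apply/eqP; rewrite -oppr_eq0 -bias_negb bA.
Qed.

End Bicolorings.

(** For [i < m] both [i] and [i.+1] lie below [m.+1], so [inord] never takes its default value. *)
Definition consecutive_pairs m : {set {set 'I_m.+1}} :=
  [set [set inord i; inord i.+1] | i : 'I_m].

Lemma card_consecutive_pairs m : #|consecutive_pairs m| <= m.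
Proof. by rewrite -[leqRHS]card_ord leq_imset_card. Qed.

Lemma inord_neqS m (i : 'I_m) : inord i != inord i.+1 :> 'I_m.+1.
Proof. by rewrite -val_eqE /= !inordK ?ltnS ?ltn_eqF // ltnW. Qed.

Lemma sizes_consecutive_pairs m : sizes_in 2 m.+1 (consecutive_pairs m).
Proof.
apply/forall_inP => _ /imsetP[i _ ->]; rewrite cards2 inord_neqS /=.
(* The index [i : 'I_m] forces [0 < m], hence [2 <= m.+1]. *)
by have := ltn_ord i; lia.
Qed.

(** Without a change, induction carries the color of [ord0] to every point. *)
Lemma nontrivial_change m (B : bicoloring m.+1) : ~~ trivial_bicoloring B ->
  exists i : 'I_m, B (inord i) != B (inord i.+1).
Proof.
move=> ntB; apply/existsP; apply: contraR ntB; rewrite negb_exists.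
move/forallP => eqB; apply/existsP; exists (B ord0); apply/forallP => j.
rewrite -[j]inord_val; elim: (val j) (ltn_ord j) => [_|i IHi lt_i].
  by rewrite (_ : inord 0 = ord0) //; apply: val_inj; rewrite /= inordK.
have := eqB (Ordinal (lt_i : i < m)); rewrite negbK => /eqP <-.
by apply: IHi; apply: ltnW.
Qed.

Lemma consecutive_pairs_SUR m k1 k2 (BB : {set bicoloring m.+1}) :
  admissible_bicolorings k1 k2 BB -> is_SUR BB (consecutive_pairs m).
Proof.
move=> /forall_inP admBB; apply/forall_inP => B /admBB /andP[ntB _].
have [i Bi] := nontrivial_change ntB.
apply/exists_inP; exists [set inord i; inord i.+1]; first exact: imset_f.
rewrite /unbiased_rep dotp_bias -card_gt0 cards2 /bias.
by rewrite big_setU1 ?inE ?inord_neqS // big_set1; move: Bi; do 2!case: (B _).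
Qed.

Theorem theorem1 (n k : nat) (hn : 0 < n) (hk : 1 <= k <= uphalf n) :
  gamma n 1 (n - k) 2 n = n - 1.
Proof.
apply/eqP; rewrite eqn_leq; apply/andP; split.
  apply/bigmax_leqP => BB; case: n hn {hk} BB => // m _ BB admBB.
  rewrite subn1 /=; apply: leq_trans (card_consecutive_pairs m).
  apply: min_SUR_le (sizes_consecutive_pairs m).
  exact: consecutive_pairs_SUR admBB.
have [_ le_k] := andP hk.
(* The extremal set consists of all admissible bicolorings. *)
set BB : {set bicoloring n} := [set B | ~~ trivial_bicoloring B
  & 1 <= #|color_class B true| <= n - k].
have admBB : admissible_bicolorings 1 (n - k) BB.
  by apply/forall_inP => B; rewrite inE.
apply: leq_trans (leq_bigmax_cond _ admBB).
(* The default value [(2 ^ n).+1] already exceeds [n - 1]. *)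
have [->|[AA [surAA /forall_inP sizeAA <-]]] := min_SUR_attained 2 n BB.
  by have := ltn_expl n (isT : 1 < 2); lia.
apply: card_unbiased_family => [|B ntB].
  by apply/negP => /sizeAA; rewrite cards0.
exact: SUR_all_nontrivial le_k surAA B ntB.
Qed.
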